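(* Let $\Omega$ be a quasi-product with quasi-factors $\Lambda$ (a $k_1$-graph) and $\Gamma$ (a $k_2$-graph). Assume that $\Lambda$ is connected. Suppose that for each $p\in G(\Lambda)^*$ the map $\widehat p_\vartriangleright:\Omega_2^{s(p)}\to\Omega_2^{r(p)}$ is bijective, and that for any paths $\xi,\xi'\in\widehat G(\Lambda)^*$ one has $\widehat\xi_\vartriangleright=\widehat{\xi'}_\vartriangleright$ whenever $r(\xi)=r(\xi')$ and $s(\xi)=s(\xi')$. Then there is an isomorphism $\Theta:\Omega\cong\widetilde\Omega$ of $(k_1+k_2)$-graphs, where $\widetilde\Omega$ is a quasi-product with quasi-factor $\Lambda$ and stable quasi-factor $\Gamma$.
   Context: Conventions: $\mathbb N=\{0,1,2,\dots\}$ and $e_1,\dots,e_k$ is the standard basis of $\mathbb N^k$. A $k$-graph is a countable category $\Lambda$ (objects identified with identity morphisms) with a functor $d:\Lambda\to\mathbb N^k$ such that whenever $d(\lambda)=m+n$ there are unique $\mu,\nu\in\Lambda$ with $\lambda=\mu\nu$, $d(\mu)=m$, $d(\nu)=n$. Write $\Lambda^0=d^{-1}(0)$, and $r(\lambda),s(\lambda)$ for range and source; $\mu\nu$ is defined when $s(\mu)=r(\nu)$. Isomorphisms of $k$-graphs are bijective degree-preserving functors. The one-skeleton $G(\Lambda)$ is the edge-colored directed graph with vertex set $\Lambda^0$, edge set $\{\lambda: d(\lambda)\in\{e_1,\dots,e_k\}\}$, source and range inherited from $\Lambda$, and $d(e)$ as the color of $e$. $\Lambda$ is connected if the undirected graph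 underlying $G(\Lambda)$ is connected. Isomorphisms of edge-colored directed graphs preserve source, range and color. For a directed graph $G$, $G^*$ is its category of finite paths $p_1\cdots p_n$ with $s(p_i)=r(p_{i+1})$ (vertices are paths of length $0$). The color order of $p_1\cdots p_n$ is $(d(p_1),\dots,d(p_n))$. Two paths in $G(\Lambda)^*$ are equivalent if they have the same composite in $\Lambda$; $[p]$ denotes the class (composite) of $p$. By the factorization property, for each path $p$ and each permutation of its color order there is exactly one path equivalent to $p$ with that color order. If $\Lambda$ is a $k_1$-graph and $\Gamma$ a $k_2$-graph, $\Lambda\times\Gamma$ is the product $(k_1+k_2)$-graph with degree $(d_\Lambda,d_\Gamma)$. Its one-skeleton has vertices $\Lambda^0\times\Gamma^0$ and edges $(e,v)$ ($e$ an edge of $G(\Lambda)$, $v\in\Gamma^0$; colored as $e$) and $(x,f)$ ($x\in\Lambda^0$, $f$ an edge of $G(\Gamma)$; colored $e_{k_1+j}$ if $f$ has color $e_j$), with source and range computed coordinatewise. A $(k_1+k_2)$-graph $\Omega$ is a quasi-product with quasi-factors $\Lambda$ (a $k_1$-graph) and $\Gamma$ (a $k_2$-graph) if: (i) $G(\Omega)\cong G(\Lambda\times\Gamma)$; (ii) there are injective functors $\psi_1:\Lambda\to\Omega$ and $\psi_2:\Gamma\to\Omega$; (iii) $d_\Lambda=\pi_1 d_\Omega\psi_1$ and $d_\Gamma=\pi_2d_\Omega\psi_2$, where $\pi_i:\mathbb N^{k_1}\times\mathbb N^{k_2}\to\mathbb N^{k_i}$ are the projections. One fixes the identification $G(\Omega)=G(\Lambda\times\Gamma)$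 and labels edges and paths of $G(\Omega)$ accordingly. Put $\Omega_1=d^{-1}(\mathbb N^{k_1}\times\{0\})$, $\Omega_2=d^{-1}(\{0\}\times\mathbb N^{k_2})$. Then $\Omega_1=\bigsqcup_{w\in\Gamma^0}\Omega_1^w\times\{w\}$ and $\Omega_2=\bigsqcup_{x\in\Lambda^0}\{x\}\times\Omega_2^x$, where $\Omega_1^w\times\{w\}$ (resp. $\{x\}\times\Omega_2^x$) is the $k_1$-graph (resp. $k_2$-graph) of all elements of $\Omega$ represented by paths in $G(\Lambda)\times\{w\}$ (resp. $\{x\}\times G(\Gamma)$). For $p\in G(\Lambda)^*$, $([p],w)$ denotes the element of $\Omega_1^w\times\{w\}$ represented by the path $(p,w)$; similarly $(x,[q])$ for $q\in G(\Gamma)^*$, and $[q]_x\in\Omega_2^x$ is the corresponding element. Conditions (ii)-(iii) in the definition of quasi-product are understood to guarantee that there are $w_0\in\Gamma^0$ and $x_0\in\Lambda^0$ with $\Omega_1^{w_0}\cong\Lambda$ and $\Omega_2^{x_0}\cong\Gamma$ as $k_1$- and $k_2$-graphs, respectively. Given $p\in G(\Lambda)^*$ and $q\in G(\Gamma)^*$, the element $([p],r(q))(s(p),[q])\in\Omega$ factors uniquely as $\beta\alpha$ with $\beta\in\Omega_2$, $\alpha\in\Omega_1$. Here $d(\beta)=d(s(p),[q])$, $d(\alpha)=d([p],r(q))$, $\beta\in\{r(p)\}\times\Omega_2^{r(p)}$ and $\alpha\in\Omega_1^{s(q)}\times\{s(q)\}$. Define $p_\vartriangleright(q)\in G(\Gamma)^*$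 to be the unique path with the same color order as $q$ such that $(r(p),[p_\vartriangleright(q)])=\beta$. The map $p_\vartriangleright:G(\Gamma)^*\to G(\Gamma)^*$ preserves color order, source and range, and induces a well-defined map $\widehat p_\vartriangleright:\Omega_2^{s(p)}\to\Omega_2^{r(p)}$, $[q]_{s(p)}\mapsto[p_\vartriangleright(q)]_{r(p)}$. $\Gamma$ is a stable quasi-factor of $\Omega$ if $p_\vartriangleright=\mathrm{id}$ on $G(\Gamma)^*$ for all $p\in G(\Lambda)^*$. For a directed graph $G$, $\widehat G$ is the directed graph with the same vertices and with edges $\{e_+,e_-:e\text{ an edge of }G\}$, where $s(e_+)=s(e)=r(e_-)$ and $r(e_+)=r(e)=s(e_-)$; write $\widehat G(\Lambda)=\widehat{G(\Lambda)}$. When all $\widehat e_\vartriangleright$ ($e$ an edge of $G(\Lambda)$) are bijective, for a path $\xi=e^1_\pm e^2_\pm\cdots e^n_\pm\in\widehat G(\Lambda)^*$ one sets $\widehat\xi_\vartriangleright=(\widehat{e^1}_\vartriangleright)^{\pm1}\circ\cdots\circ(\widehat{e^n}_\vartriangleright)^{\pm1}:\Omega_2^{s(\xi)}\to\Omega_2^{r(\xi)}$ (the identity for paths of length $0$). *)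

(* Defs.v *)
From mathcomp Require Import all_boot all_order all_algebra.
From mathcomp Require Import boolp.
From Stdlib Require Import Relation_Operators.

Set Implicit Arguments.
Unset Strict Implicit.
Unset Printing Implicit Defensive.

Import GRing.Theory.
Local Open Scope ring_scope.

Notation "''N^' k" := ('rV[nat]_k) (at level 8, k at level 2, format "''N^' k").

Definition is_basis k (m : 'N^k) : bool := [exists i : 'I_k, m == delta_mx 0 i].

(* [kcomp mu nu] is the composite mu nu when [ksrc mu = krng nu]; outside the
   composable pairs its value carries no meaning and is never used.  Objects
   are kept apart from their identity morphisms; by [deg0_id] below the latter
   are exactly the morphisms of degree 0. *)
Record kgraph (k : nat) := KGraph {
  kobj : Type;
  kmor : Type;
  krng : kmor -> kobj;
  ksrc : kmor -> kobj;
  kid : kobj -> kmor;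
  kcomp : kmor -> kmor -> kmor;
  kdeg : kmor -> 'N^k;
  krng_id : forall v, krng (kid v) = v;
  ksrc_id : forall v, ksrc (kid v) = v;
  krng_comp : forall a b, ksrc a = krng b -> krng (kcomp a b) = krng a;
  ksrc_comp : forall a b, ksrc a = krng b -> ksrc (kcomp a b) = ksrc b;
  kcomp_idl : forall a, kcomp (kid (krng a)) a = a;
  kcomp_idr : forall a, kcomp a (kid (ksrc a)) = a;
  kcompA : forall a b c, ksrc a = krng b -> ksrc b = krng c ->
    kcomp a (kcomp b c) = kcomp (kcomp a b) c;
  kdeg_id : forall v, kdeg (kid v) = 0;
  kdeg_comp : forall a b, ksrc a = krng b -> kdeg (kcomp a b) = kdeg a + kdeg b;
  kfactor : forall l m n, kdeg l = m + n -> exists! p : kmor * kmor,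
    [/\ ksrc p.1 = krng p.2, kcomp p.1 p.2 = l, kdeg p.1 = m & kdeg p.2 = n];
  kcountable : exists f : kmor -> nat, injective f
}.
Arguments kid {k} k0 v : rename.

Record kfunctor k l (L : kgraph k) (M : kgraph l) := KFunctor {
  fobj : kobj L -> kobj M;
  fmor :> kmor L -> kmor M;
  frng : forall a, krng (fmor a) = fobj (krng a);
  fsrc : forall a, ksrc (fmor a) = fobj (ksrc a);
  fid : forall v, fmor (kid L v) = kid M (fobj v);
  fcomp : forall a b, ksrc a = krng b -> fmor (kcomp a b) = kcomp (fmor a) (fmor b)
}.

Definition kisomorphic k (L M : kgraph k) : Prop :=
  exists F : kfunctor L M, bijective F /\ forall a, kdeg (F a) = kdeg a.

Record digraph := Digraph {
  vert : Type;
  edge : Type;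
  erng : edge -> vert;
  esrc : edge -> vert
}.

Record cgraph k := CGraph {
  cdigraph :> digraph;
  ecol : edge cdigraph -> 'N^k
}.

Record gmor (G H : digraph) := GMor {
  gv : vert G -> vert H;
  ge : edge G -> edge H;
  gmor_rng : forall e, erng (ge e) = gv (erng e);
  gmor_src : forall e, esrc (ge e) = gv (esrc e)
}.

Record cgiso k (G H : cgraph k) := CGIso {
  ci_mor :> gmor G H;
  ci_vbij : bijective (gv ci_mor);
  ci_ebij : bijective (ge ci_mor);
  ci_col : forall e, ecol (ge ci_mor e) = ecol e
}.

(* [paths G x y] is the set of paths with range x and source y.  The endpoint
   conditions are explicit equations so that images of paths under graph
   morphisms need no transport. *)
Inductive gpath (G : digraph) (y : vert G) : vert G -> Type :=
| pnil : gpath y y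
| pcons x z (e : edge G) : erng e = x -> esrc e = z -> gpath y z -> gpath y x.
Arguments pnil {G y}.
Arguments pcons {G y x z} e _ _ _.
Notation paths G x y := (@gpath G y x).

Fixpoint map_path G H (F : gmor G H) x y (p : paths G x y) :
    paths H (gv F x) (gv F y) :=
  match p in gpath _ x0 return gpath (gv F y) (gv F x0) with
  | pnil => pnil
  | pcons _ _ e hr hs p' =>
      pcons (ge F e) (etrans (gmor_rng F e) (congr1 (gv F) hr))
            (etrans (gmor_src F e) (congr1 (gv F) hs)) (map_path F p')
  end.

Fixpoint color_order k (G : cgraph k) x y (p : paths G x y) : seq 'N^k :=
  match p with
  | pnil => [::]
  | pcons _ _ e _ _ p' => ecol e :: color_order p'
  end.

Definition connected_graph (G : digraph) : Prop :=
  forall x y, clos_refl_sym_trans (vert G)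
    (fun u v => exists e : edge G, erng e = u /\ esrc e = v) x y.

(* The edges (e, true) and (e, false) are e_+ and e_-. *)
Definition hat_graph (G : digraph) : digraph :=
  @Digraph (vert G) (edge G * bool)
    (fun e => if e.2 then erng e.1 else esrc e.1)
    (fun e => if e.2 then esrc e.1 else erng e.1).

Definition skel k (L : kgraph k) : cgraph k :=
  @CGraph k (@Digraph (kobj L) {a : kmor L | is_basis (kdeg a)}
               (fun e => krng (val e)) (fun e => ksrc (val e)))
    (fun e => kdeg (val e)).

Definition kconnected k (L : kgraph k) : Prop := connected_graph (skel L).

Fixpoint composite k (L : kgraph k) x y (p : paths (skel L) x y) : kmor L :=
  match p with
  | pnil => kid L y
  | pcons _ _ e _ _ p' => kcomp (val e) (composite p')
  end.

Lemma deg0_id k (L : kgraph k) (a : kmor L) : kdeg a = 0 -> a = kid L (krng a).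
Proof.
move=> da.
have [p [hp u]] : exists! p : kmor L * kmor L,
    [/\ ksrc p.1 = krng p.2, kcomp p.1 p.2 = a, kdeg p.1 = 0 & kdeg p.2 = 0].
  by apply: kfactor; rewrite addr0.
have h1 : p = (kid L (krng a), a).
  by apply: u; split=> //=; rewrite ?ksrc_id ?kcomp_idl ?kdeg_id.
have h2 : p = (a, kid L (ksrc a)).
  by apply: u; split=> //=; rewrite ?krng_id ?kcomp_idr ?kdeg_id.
by move: h1; rewrite h2 => -[].
Qed.

Lemma kfactor_inj k (L : kgraph k) (a b a' b' : kmor L) :
  ksrc a = krng b -> ksrc a' = krng b' -> kcomp a b = kcomp a' b' ->
  kdeg a = kdeg a' -> kdeg b = kdeg b' -> a = a' /\ b = b'.
Proof.
move=> h h' e da db.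
have [p [_ u]] := kfactor (kdeg_comp h).
have h1 : p = (a, b) by apply: u.
have h2 : p = (a', b') by apply: u; split=> //=; rewrite -?da -?db.
by move: h1; rewrite h2 => -[].
Qed.

Lemma krng_composite k (L : kgraph k) x y (p : paths (skel L) x y) :
  krng (composite p) = x /\ ksrc (composite p) = y.
Proof.
elim: p => [|x' z e hr hs p [IHr IHs]] /=; first by rewrite krng_id ksrc_id.
have h : ksrc (val e) = krng (composite p) by rewrite IHr.
by rewrite krng_comp // ksrc_comp.
Qed.

Lemma kdeg_composite k (L : kgraph k) x y (p : paths (skel L) x y) :
  kdeg (composite p) = \sum_(c <- color_order p) c.
Proof.
elim: p => [|x' z e hr hs p IH] /=; first by rewrite kdeg_id big_nil.
by rewrite kdeg_comp ?big_cons ?IH // (krng_composite p).1.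
Qed.

Lemma color_order_basis k (L : kgraph k) x y (p : paths (skel L) x y) :
  all (@is_basis k) (color_order p).
Proof. by elim: p => //= x' z e _ _ p ->; rewrite (valP e). Qed.

Lemma sum_basis k (m : 'N^k) :
  exists2 cs, all (@is_basis k) cs & m = \sum_(c <- cs) c.
Proof.
exists (flatten [seq nseq (m 0 i) (delta_mx 0 i) | i <- enum 'I_k]).
  apply/allP => c /flattenP [s /mapP [i _ ->]] /nseqP [-> _].
  by apply/existsP; exists i.
rewrite big_flatten /= big_map big_enum /= {1}[m]row_sum_delta.
apply: eq_bigr => i _; rewrite big_nseq iter_addr_0.
by apply/rowP => j; rewrite !mxE mulmxnE !mxE; case: (_ && _);
   rewrite ?mulr1 ?mulr0 ?mul0rn //= natrE natn.
Qed.

Lemma row_mx_add k l (a : 'N^k) (c : 'N^l) (m n : 'N^(k + l)) :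
  row_mx a c = m + n ->
  a = lsubmx m + lsubmx n /\ c = rsubmx m + rsubmx n.
Proof. by rewrite -{1}[m]hsubmxK -{1}[n]hsubmxK add_row_mx => /eq_row_mx. Qed.

Section Product.
Context (k l : nat) (L : kgraph k) (M : kgraph l).

Definition kprod_obj := (kobj L * kobj M)%type.
Definition kprod_mor := (kmor L * kmor M)%type.
Definition kprod_rng (a : kprod_mor) : kprod_obj := (krng a.1, krng a.2).
Definition kprod_src (a : kprod_mor) : kprod_obj := (ksrc a.1, ksrc a.2).
Definition kprod_id (v : kprod_obj) : kprod_mor := (kid L v.1, kid M v.2).
Definition kprod_comp (a b : kprod_mor) : kprod_mor := (kcomp a.1 b.1, kcomp a.2 b.2).
Definition kprod_deg (a : kprod_mor) : 'N^(k + l) := row_mx (kdeg a.1) (kdeg a.2).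

Fact prod_rng_id v : kprod_rng (kprod_id v) = v.
Proof. by case: v => v w; rewrite /kprod_rng /= !krng_id. Qed.
Fact prod_src_id v : kprod_src (kprod_id v) = v.
Proof. by case: v => v w; rewrite /kprod_src /= !ksrc_id. Qed.
Fact prod_rng_comp a b : kprod_src a = kprod_rng b -> kprod_rng (kprod_comp a b) = kprod_rng a.
Proof. by case=> h1 h2; rewrite /kprod_rng /= !krng_comp. Qed.
Fact prod_src_comp a b : kprod_src a = kprod_rng b -> kprod_src (kprod_comp a b) = kprod_src b.
Proof. by case=> h1 h2; rewrite /kprod_src /= !ksrc_comp. Qed.
Fact prod_idl a : kprod_comp (kprod_id (kprod_rng a)) a = a.
Proof. by case: a => a b; rewrite /kprod_comp /= !kcomp_idl. Qed.
Fact prod_idr a : kprod_comp a (kprod_id (kprod_src a)) = a.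
Proof. by case: a => a b; rewrite /kprod_comp /= !kcomp_idr. Qed.
Fact prod_compA a b c : kprod_src a = kprod_rng b -> kprod_src b = kprod_rng c ->
  kprod_comp a (kprod_comp b c) = kprod_comp (kprod_comp a b) c.
Proof. by case=> h1 h2 [h3 h4]; rewrite /kprod_comp /= !kcompA. Qed.
Fact prod_deg_id v : kprod_deg (kprod_id v) = 0.
Proof. by rewrite /kprod_deg /= !kdeg_id row_mx0. Qed.
Fact prod_deg_comp a b : kprod_src a = kprod_rng b -> kprod_deg (kprod_comp a b) = kprod_deg a + kprod_deg b.
Proof. by case=> h1 h2; rewrite /kprod_deg /= !kdeg_comp // add_row_mx. Qed.

Fact prod_factor a m n : kprod_deg a = m + n -> exists! p : kprod_mor * kprod_mor,
  [/\ kprod_src p.1 = kprod_rng p.2, kprod_comp p.1 p.2 = a, kprod_deg p.1 = m & kprod_deg p.2 = n].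
Proof.
case: a => a b /row_mx_add [ha hb].
have [[a1 a2] [/= [sa <- da1 da2] _]] := kfactor ha.
have [[b1 b2] [/= [sb <- db1 db2] _]] := kfactor hb.
exists ((a1, b1), (a2, b2)); split=> /=.
  split; rewrite /kprod_src /kprod_rng /kprod_deg /= ?sa ?sb //.
    by rewrite da1 db1 hsubmxK.
  by rewrite da2 db2 hsubmxK.
case=> -[c1 d1] [c2 d2] /= [[sc sd] [ec ed] dm dn].
have [] := @kfactor_inj _ _ a1 a2 c1 c2; rewrite ?ec //.
- by rewrite da1 -dm row_mxKl.
- by rewrite da2 -dn row_mxKl.
have [] := @kfactor_inj _ _ b1 b2 d1 d2; rewrite ?ed //.
- by rewrite db1 -dm row_mxKr.
- by rewrite db2 -dn row_mxKr.
by move=> -> -> -> ->.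
Qed.

Fact prod_countable : exists f : kprod_mor -> nat, injective f.
Proof.
have [f fi] := kcountable L; have [g gi] := kcountable M.
exists (fun a => pickle (f a.1, g a.2)) => -[a b] [c d].
by move=> /(pcan_inj pickleK) [/fi -> /gi ->].
Qed.

Definition kprod : kgraph (k + l) :=
  KGraph prod_rng_id prod_src_id prod_rng_comp prod_src_comp prod_idl prod_idr
    prod_compA prod_deg_id prod_deg_comp prod_factor prod_countable.

Lemma is_basis_l (m : 'N^k) : is_basis m -> is_basis (row_mx m 0 : 'N^(k + l)).
Proof.
case/existsP=> i /eqP ->; apply/existsP; exists (lshift l i).
apply/eqP/rowP => j; rewrite !mxE; case: (split_ordP j) => j' -> /=.
  by rewrite mxE eq_lshift.
by rewrite mxE eq_rlshift.
Qed.

Lemma is_basis_r (m : 'N^l) : is_basis m -> is_basis (row_mx 0 m : 'N^(k + l)).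
Proof.
case/existsP=> i /eqP ->; apply/existsP; exists (rshift k i).
apply/eqP/rowP => j; rewrite !mxE; case: (split_ordP j) => j' -> /=.
  by rewrite mxE eq_lrshift.
by rewrite mxE eq_rshift.
Qed.

End Product.

Fact left_edge_basis k l (L : kgraph k) (M : kgraph l) (w : kobj M)
  (e : edge (skel L)) : is_basis (@kdeg _ (kprod L M) (val e, kid M w)).
Proof. by rewrite /= /kprod_deg /= kdeg_id is_basis_l // (valP e). Qed.

Fact right_edge_basis k l (L : kgraph k) (M : kgraph l) (x : kobj L)
  (f : edge (skel M)) : is_basis (@kdeg _ (kprod L M) (kid L x, val f)).
Proof. by rewrite /= /kprod_deg /= kdeg_id is_basis_r // (valP f). Qed.

(* G(Lambda) x {w} and {x} x G(Gamma) inside G(Lambda x Gamma): the edges (e, w)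
   and (x, f) are the morphisms (e, id_w) and (id_x, f) of the product. *)
Definition left_incl k l (L : kgraph k) (M : kgraph l) (w : kobj M) :
    gmor (skel L) (skel (kprod L M)) :=
  @GMor (skel L) (skel (kprod L M)) (fun x => (x, w))
    (fun e => exist (fun a : kmor (kprod L M) => is_basis (kdeg a)) _ (left_edge_basis w e))
    (fun e => congr1 (pair _) (krng_id w)) (fun e => congr1 (pair _) (ksrc_id w)).

Definition right_incl k l (L : kgraph k) (M : kgraph l) (x : kobj L) :
    gmor (skel M) (skel (kprod L M)) :=
  @GMor (skel M) (skel (kprod L M)) (fun w => (x, w))
    (fun f => exist (fun a : kmor (kprod L M) => is_basis (kdeg a)) _ (right_edge_basis x f))
    (fun f => congr1 (pair^~ _) (krng_id x)) (fun f => congr1 (pair^~ _) (ksrc_id x)).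

(* A set of morphisms closed under composition and under factors, whose degrees
   lie in the image of an additive embedding [j] of N^l, is an l-graph. *)
Record subcat k l (O : kgraph k) (j : 'N^l -> 'N^k) (pi : 'N^k -> 'N^l)
    (P : kmor O -> Prop) : Prop := SubCat {
  sub_j : forall m n, j (m + n) = j m + j n;
  sub_pi : forall m n, pi (m + n) = pi m + pi n;
  sub_pi0 : pi 0 = 0;
  sub_jK : cancel j pi;
  sub_deg : forall a, P a -> kdeg a = j (pi (kdeg a));
  sub_comp : forall a b, P a -> P b -> ksrc a = krng b -> P (kcomp a b);
  sub_fac : forall a b, ksrc a = krng b -> P (kcomp a b) -> P a /\ P b
}.

Section SubGraph.
Context (k l : nat) (O : kgraph k) (j : 'N^l -> 'N^k) (pi : 'N^k -> 'N^l).
Context (P : kmor O -> Prop) (H : subcat j pi P).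

Fact sub_id_rng a : P a -> P (kid O (krng a)).
Proof.
move=> Pa; have h := ksrc_id (krng a).
by move: (Pa); rewrite -{1}[a]kcomp_idl => /(sub_fac H h) [].
Qed.
Fact sub_id_src a : P a -> P (kid O (ksrc a)).
Proof.
move=> Pa; have h := esym (krng_id (ksrc a)).
by move: (Pa); rewrite -{1}[a]kcomp_idr => /(sub_fac H h) [].
Qed.

Definition sub_obj := {v : kobj O | P (kid O v)}.
Definition sub_mor := {a : kmor O | P a}.
Definition sub_rng (a : sub_mor) : sub_obj :=
  exist _ (krng (sval a)) (sub_id_rng (svalP a)).
Definition sub_src (a : sub_mor) : sub_obj :=
  exist _ (ksrc (sval a)) (sub_id_src (svalP a)).
Definition sub_kid (v : sub_obj) : sub_mor := exist _ (kid O (sval v)) (svalP v).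
Definition sub_kcomp (a b : sub_mor) : sub_mor :=
  if pselect (ksrc (sval a) = krng (sval b)) is left h
  then exist _ (kcomp (sval a) (sval b)) (sub_comp H (svalP a) (svalP b) h)
  else a.
Definition sub_kdeg (a : sub_mor) : 'N^l := pi (kdeg (sval a)).

Fact sub_eq (T : Type) (Q : T -> Prop) (a b : {x : T | Q x}) :
  sval a = sval b -> a = b.
Proof.
case: a b => [a Qa] [b Qb] /= e; case: _ / e Qb => Qb.
by congr exist; apply: Prop_irrelevance.
Qed.

Fact sval_comp a b : sub_src a = sub_rng b ->
  sval (sub_kcomp a b) = kcomp (sval a) (sval b).
Proof. by move=> [h]; rewrite /sub_kcomp; case: pselect. Qed.

Fact sub_rng_id v : sub_rng (sub_kid v) = v.
Proof. by apply: sub_eq; rewrite /= krng_id. Qed.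
Fact sub_src_id v : sub_src (sub_kid v) = v.
Proof. by apply: sub_eq; rewrite /= ksrc_id. Qed.
Fact sub_rng_comp a b : sub_src a = sub_rng b -> sub_rng (sub_kcomp a b) = sub_rng a.
Proof.
by move=> h; apply: sub_eq; rewrite /= sval_comp // krng_comp //; case: h.
Qed.
Fact sub_src_comp a b : sub_src a = sub_rng b -> sub_src (sub_kcomp a b) = sub_src b.
Proof.
by move=> h; apply: sub_eq; rewrite /= sval_comp // ksrc_comp //; case: h.
Qed.
Fact sub_idl a : sub_kcomp (sub_kid (sub_rng a)) a = a.
Proof. by apply: sub_eq; rewrite sval_comp ?sub_src_id //= kcomp_idl. Qed.
Fact sub_idr a : sub_kcomp a (sub_kid (sub_src a)) = a.
Proof. by apply: sub_eq; rewrite sval_comp ?sub_rng_id //= kcomp_idr. Qed.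
Fact sub_compA a b c : sub_src a = sub_rng b -> sub_src b = sub_rng c ->
  sub_kcomp a (sub_kcomp b c) = sub_kcomp (sub_kcomp a b) c.
Proof.
move=> h h'; apply: sub_eq.
rewrite !sval_comp ?sub_rng_comp ?sub_src_comp //.
by apply: kcompA; [case: h | case: h'].
Qed.
Fact sub_deg_id v : sub_kdeg (sub_kid v) = 0.
Proof. by rewrite /sub_kdeg /= kdeg_id (sub_pi0 H). Qed.
Fact sub_deg_comp a b : sub_src a = sub_rng b ->
  sub_kdeg (sub_kcomp a b) = sub_kdeg a + sub_kdeg b.
Proof.
move=> h; rewrite /sub_kdeg sval_comp // kdeg_comp ?(sub_pi H) //.
by case: h.
Qed.

Fact sub_factor a m n : sub_kdeg a = m + n -> exists! p : sub_mor * sub_mor,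
  [/\ sub_src p.1 = sub_rng p.2, sub_kcomp p.1 p.2 = a,
      sub_kdeg p.1 = m & sub_kdeg p.2 = n].
Proof.
case: a => a Pa da.
have da' : kdeg a = j m + j n by rewrite (sub_deg H Pa) -(sub_j H) -da.
have [[b c] [/= [h e db dc] _]] := kfactor da'.
have [Pb Pc] : P b /\ P c by apply: (sub_fac H h); rewrite e.
have h' : sub_src (exist _ b Pb) = sub_rng (exist _ c Pc) by apply: sub_eq.
exists (exist _ b Pb, exist _ c Pc); split=> /=.
  split=> //; first by apply: sub_eq; rewrite sval_comp.
    by rewrite /sub_kdeg /= db (sub_jK H).
  by rewrite /sub_kdeg /= dc (sub_jK H).
case=> -[b' Pb'] [c' Pc'] /= [hs hc hm hn].
have hs' : ksrc b' = krng c' by case: hs.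
have [e1 e2] : b = b' /\ c = c'.
  apply: kfactor_inj => //.
  - by have := congr1 sval hc; rewrite sval_comp // e => ->.
  - by rewrite db -hm /sub_kdeg /= -(sub_deg H Pb').
  - by rewrite dc -hn /sub_kdeg /= -(sub_deg H Pc').
by congr pair; apply: sub_eq.
Qed.

Fact sub_countable : exists f : sub_mor -> nat, injective f.
Proof.
have [f fi] := kcountable O.
by exists (fun a => f (sval a)) => a b /fi; apply: sub_eq.
Qed.

Definition sub_kgraph : kgraph l :=
  KGraph sub_rng_id sub_src_id sub_rng_comp sub_src_comp sub_idl sub_idr
    sub_compA sub_deg_id sub_deg_comp sub_factor sub_countable.

End SubGraph.

Section Skeletons.
Context (k1 k2 : nat) (L : kgraph k1) (M : kgraph k2) (O : kgraph (k1 + k2)).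
Context (io : cgiso (skel (kprod L M)) (skel O)).

Definition left_br (w : kobj M) x y (p : paths (skel L) x y) : kmor O :=
  composite (map_path io (map_path (left_incl L w) p)).

Definition right_br (x : kobj L) v w (q : paths (skel M) v w) : kmor O :=
  composite (map_path io (map_path (right_incl M x) q)).

Definition in_left (w : kobj M) (a : kmor O) : Prop :=
  exists x y (p : paths (skel L) x y), a = left_br w p.

Definition in_right (x : kobj L) (b : kmor O) : Prop :=
  exists v w (q : paths (skel M) v w), b = right_br x q.

Lemma left_br_ends w x y (p : paths (skel L) x y) :
  krng (left_br w p) = gv io (x, w) /\ ksrc (left_br w p) = gv io (y, w).
Proof. exact: krng_composite. Qed.

Lemma right_br_ends x v w (q : paths (skel M) v w) :
  krng (right_br x q) = gv io (x, v) /\ ksrc (right_br x q) = gv io (x, w).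
Proof. exact: krng_composite. Qed.

Lemma gv_inj x w x' w' : gv io (x, w) = gv io (x', w') -> x = x' /\ w = w'.
Proof. by move=> /(bij_inj (ci_vbij io)) []. Qed.

Lemma src_left w (e : edge (skel L)) :
  ksrc (val (ge io (ge (left_incl L w) e))) = gv io (esrc e, w).
Proof. by have /= -> := gmor_src io (ge (left_incl L w) e); rewrite /kprod_src /= ksrc_id. Qed.

Lemma src_right x (f : edge (skel M)) :
  ksrc (val (ge io (ge (right_incl M x) f))) = gv io (x, esrc f).
Proof. by have /= -> := gmor_src io (ge (right_incl M x) f); rewrite /kprod_src /= ksrc_id. Qed.

Lemma deg_left w (e : edge (skel L)) :
  kdeg (val (ge io (ge (left_incl L w) e))) = row_mx (ecol e) 0.
Proof.
have /= -> := ci_col io (ge (left_incl L w) e).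
by rewrite /kprod_deg /= kdeg_id.
Qed.

Lemma deg_right x (f : edge (skel M)) :
  kdeg (val (ge io (ge (right_incl M x) f))) = row_mx 0 (ecol f).
Proof.
have /= -> := ci_col io (ge (right_incl M x) f).
by rewrite /kprod_deg /= kdeg_id.
Qed.

Lemma left_br_deg w x y (p : paths (skel L) x y) :
  kdeg (left_br w p) = row_mx (\sum_(c <- color_order p) c) 0.
Proof.
rewrite /left_br; elim: p => [|x' z e hr hs p IH] /=.
  by rewrite kdeg_id big_nil row_mx0.
rewrite kdeg_comp; last first.
  by have [-> _] := left_br_ends w p; rewrite src_left hs.
by rewrite {}IH big_cons deg_left add_row_mx add0r.
Qed.

Lemma right_br_deg x v w (q : paths (skel M) v w) :
  kdeg (right_br x q) = row_mx 0 (\sum_(c <- color_order q) c).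
Proof.
rewrite /right_br; elim: q => [|v' z e hr hs q IH] /=.
  by rewrite kdeg_id big_nil row_mx0.
rewrite kdeg_comp; last first.
  by have [-> _] := right_br_ends x q; rewrite src_right hs.
by rewrite {}IH big_cons deg_right add_row_mx add0r.
Qed.

Lemma left_edge w x (a : kmor O) (c : 'N^k1) : is_basis c ->
  kdeg a = row_mx c 0 -> krng a = gv io (x, w) ->
  exists e : edge (skel L),
    [/\ ecol e = c, erng e = x & a = val (ge io (ge (left_incl L w) e))].
Proof.
move=> bc da ra.
have ba : is_basis (kdeg a) by rewrite da is_basis_l.
pose E : edge (skel O) := exist _ a ba.
have [g _ gK] := ci_ebij io.
have := gK E; case: (g E) => -[e1 e2] be eE.
have := ci_col io (exist _ (e1, e2) be); rewrite eE /= da /kprod_deg /=.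
move=> /eq_row_mx [d1 d2].
have := gmor_rng io (exist _ (e1, e2) be).
rewrite eE /= ra => /gv_inj [r1 r2].
have b1 : is_basis (kdeg e1) by rewrite -d1.
have hE : ge (left_incl L w) (exist _ e1 b1) = exist _ (e1, e2) be.
  by apply: val_inj => /=; rewrite [e2 in RHS]deg0_id // -r2.
exists (exist _ e1 b1); split=> //.
exact: esym (congr1 val (etrans (congr1 (ge io) hE) eE)).
Qed.

Lemma right_edge x v (a : kmor O) (c : 'N^k2) : is_basis c ->
  kdeg a = row_mx 0 c -> krng a = gv io (x, v) ->
  exists f : edge (skel M),
    [/\ ecol f = c, erng f = v & a = val (ge io (ge (right_incl M x) f))].
Proof.
move=> bc da ra.
have ba : is_basis (kdeg a) by rewrite da is_basis_r.
pose E : edge (skel O) := exist _ a ba.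
have [g _ gK] := ci_ebij io.
have := gK E; case: (g E) => -[e1 e2] be eE.
have := ci_col io (exist _ (e1, e2) be); rewrite eE /= da /kprod_deg /=.
move=> /eq_row_mx [d1 d2].
have := gmor_rng io (exist _ (e1, e2) be).
rewrite eE /= ra => /gv_inj [r1 r2].
have b2 : is_basis (kdeg e2) by rewrite -d2.
have hE : ge (right_incl M x) (exist _ e2 b2) = exist _ (e1, e2) be.
  by apply: val_inj => /=; rewrite [e1 in RHS]deg0_id // -r1.
exists (exist _ e2 b2); split=> //.
exact: esym (congr1 val (etrans (congr1 (ge io) hE) eE)).
Qed.

Lemma left_path w cs x (a : kmor O) : all (@is_basis k1) cs ->
  kdeg a = row_mx (\sum_(c <- cs) c) 0 -> krng a = gv io (x, w) ->
  exists y (p : paths (skel L) x y), color_order p = cs /\ a = left_br w p.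
Proof.
elim: cs x a => [|c cs IH] x a /=.
  rewrite big_nil row_mx0 => _ /deg0_id -> ra; exists x, pnil.
  by move: ra; rewrite krng_id => ->.
case/andP=> bc bcs; rewrite big_cons => da ra.
have da' : kdeg a = row_mx c 0 + row_mx (\sum_(c <- cs) c) 0.
  by rewrite add_row_mx addr0.
have [[a1 a2] [/= [h e d1 d2] _]] := kfactor da'.
have [|f [cf rf a1E]] := left_edge (w := w) (x := x) bc d1.
  by rewrite -ra -e krng_comp.
have [|y [p [cp a2E]]] := IH (esrc f) a2 bcs d2.
  by rewrite -h a1E src_left.
exists y, (pcons f rf erefl p); split; first by rewrite /= cp -cf.
by rewrite -e a1E a2E.
Qed.

Lemma right_path x cs v (b : kmor O) : all (@is_basis k2) cs ->
  kdeg b = row_mx 0 (\sum_(c <- cs) c) -> krng b = gv io (x, v) ->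
  exists w (q : paths (skel M) v w), color_order q = cs /\ b = right_br x q.
Proof.
elim: cs v b => [|c cs IH] v b /=.
  rewrite big_nil row_mx0 => _ /deg0_id -> rb; exists v, pnil.
  by move: rb; rewrite krng_id => ->.
case/andP=> bc bcs; rewrite big_cons => db rb.
have db' : kdeg b = row_mx 0 c + row_mx 0 (\sum_(c <- cs) c).
  by rewrite add_row_mx addr0.
have [[b1 b2] [/= [h e d1 d2] _]] := kfactor db'.
have [|f [cf rf b1E]] := right_edge (v := v) (x := x) bc d1.
  by rewrite -rb -e krng_comp.
have [|w [q [cq b2E]]] := IH (esrc f) b2 bcs d2.
  by rewrite -h b1E src_right.
exists w, (pcons f rf erefl q); split; first by rewrite /= cq -cf.
by rewrite -e b1E b2E.
Qed.

Lemma in_leftP w (a : kmor O) : in_left w a <->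
  rsubmx (kdeg a) = 0 /\ exists x, krng a = gv io (x, w).
Proof.
split=> [[x [y [p ->]]]|[da [x ra]]].
  by rewrite left_br_deg row_mxKr; split=> //; exists x; apply: (left_br_ends w p).1.
have [cs bcs csE] := sum_basis (lsubmx (kdeg a)).
have [|y [p [_ aE]]] := left_path bcs _ ra; last by exists x, y, p.
by rewrite -csE -da hsubmxK.
Qed.

Lemma in_rightP x (b : kmor O) : in_right x b <->
  lsubmx (kdeg b) = 0 /\ exists v, krng b = gv io (x, v).
Proof.
split=> [[v [w [q ->]]]|[db [v rb]]].
  by rewrite right_br_deg row_mxKl; split=> //; exists v; apply: (right_br_ends x q).1.
have [cs bcs csE] := sum_basis (rsubmx (kdeg b)).
have [|w [q [_ bE]]] := right_path bcs _ rb; last by exists v, w, q.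
by rewrite -csE -db hsubmxK.
Qed.

Lemma nvec_add0 k (m n : 'N^k) : m + n = 0 -> m = 0 /\ n = 0.
Proof.
move=> h; split; apply/rowP => i; have := congr1 (fun u : 'N^k => u 0 i) h;
  rewrite !mxE => /eqP; rewrite addn_eq0 => /andP [/eqP ? /eqP ?] //.
Qed.

Lemma lsubmx_add (m n : 'N^(k1 + k2)) : lsubmx (m + n) = lsubmx m + lsubmx n.
Proof. by apply/rowP => i; rewrite !mxE. Qed.
Lemma rsubmx_add (m n : 'N^(k1 + k2)) : rsubmx (m + n) = rsubmx m + rsubmx n.
Proof. by apply/rowP => i; rewrite !mxE. Qed.

Lemma left_subcat w :
  subcat (fun m : 'N^k1 => row_mx m (0 : 'N^k2)) lsubmx (in_left w).
Proof.
split=> [m n|||m|a|a b|a b h].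
- by rewrite add_row_mx addr0.
- exact: lsubmx_add.
- by apply/rowP => i; rewrite !mxE.
- by rewrite row_mxKl.
- by move=> /in_leftP [<- _]; rewrite hsubmxK.
- move=> /in_leftP [da [x ra]] /in_leftP [db _] h; apply/in_leftP.
  by rewrite kdeg_comp // rsubmx_add da db addr0 krng_comp //; split=> //; exists x.
- move=> /in_leftP []; rewrite kdeg_comp // rsubmx_add krng_comp //.
  move=> /nvec_add0 [da db] [x ra].
  have La : in_left w a by apply/in_leftP; split=> //; exists x.
  split=> //; apply/in_leftP; split=> //; rewrite -h.
  by case: La => x' [y' [p ->]]; exists y'; apply: (left_br_ends w p).2.
Qed.

Lemma right_subcat x :
  subcat (fun m : 'N^k2 => row_mx (0 : 'N^k1) m) rsubmx (in_right x).
Proof.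
split=> [m n|||m|a|a b|a b h].
- by rewrite add_row_mx addr0.
- exact: rsubmx_add.
- by apply/rowP => i; rewrite !mxE.
- by rewrite row_mxKr.
- by move=> /in_rightP [<- _]; rewrite hsubmxK.
- move=> /in_rightP [da [v ra]] /in_rightP [db _] h; apply/in_rightP.
  by rewrite kdeg_comp // lsubmx_add da db addr0 krng_comp //; split=> //; exists v.
- move=> /in_rightP []; rewrite kdeg_comp // lsubmx_add krng_comp //.
  move=> /nvec_add0 [da db] [v ra].
  have Ra : in_right x a by apply/in_rightP; split=> //; exists v.
  split=> //; apply/in_rightP; split=> //; rewrite -h.
  by case: Ra => v' [w' [q ->]]; exists w'; apply: (right_br_ends x q).2.
Qed.

(* Omega_1^w and Omega_2^x, identified with Omega_1^w x {w} and {x} x Omega_2^x. *)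
Definition Omega1 (w : kobj M) : kgraph k1 := sub_kgraph (left_subcat w).
Definition Omega2 (x : kobj L) : kgraph k2 := sub_kgraph (right_subcat x).

End Skeletons.

(* The isomorphism of one-skeletons is part of the data, since the notions below
   depend on it.  The last two fields spell out what the existence of the
   injective functors is understood to guarantee. *)
Record quasi_product k1 k2 (L : kgraph k1) (M : kgraph k2)
    (O : kgraph (k1 + k2)) := QuasiProduct {
  qp_iso :> cgiso (skel (kprod L M)) (skel O);
  qp_psi1 : exists psi : kfunctor L O,
    injective psi /\ forall a, kdeg a = lsubmx (kdeg (psi a));
  qp_psi2 : exists psi : kfunctor M O,
    injective psi /\ forall b, kdeg b = rsubmx (kdeg (psi b));
  qp_base1 : exists w0, kisomorphic (Omega1 qp_iso w0) L;
  qp_base2 : exists x0, kisomorphic (Omega2 qp_iso x0) M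
}.

Section Action.
Context (k1 k2 : nat) (L : kgraph k1) (M : kgraph k2) (O : kgraph (k1 + k2)).
Context (io : cgiso (skel (kprod L M)) (skel O)).

(* ([p], r(q)) (s(p), [q]) = beta alpha with beta = (r(p), [q']) and alpha in
   Omega_1, where q' has the color order of q. *)
Definition is_tri x y (p : paths (skel L) x y) v w (q q' : paths (skel M) v w) :
    Prop :=
  color_order q' = color_order q /\
  exists alpha : kmor O,
    [/\ rsubmx (kdeg alpha) = 0, ksrc (right_br io x q') = krng alpha &
        kcomp (right_br io x q') alpha =
        kcomp (left_br io v p) (right_br io y q)].

Lemma nil_path k (G : cgraph k) (y x : vert G) (q : paths G x y) (h : y = x) :
  color_order q = [::] -> q = eq_rect y (fun x => paths G x y) pnil x h.
Proof. by case: q h => // h _; rewrite (Prop_irrelevance h erefl). Qed.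

Lemma right_br_inj x v w (q q' : paths (skel M) v w) :
  color_order q = color_order q' -> right_br io x q = right_br io x q' -> q = q'.
Proof.
elim: q q' => [|v' z f hr hs q IH] q'.
  by move=> /esym /(nil_path (erefl _)) ->.
case: q' hr => // v1 z' f' hr' hs' q1 hr [cf cq] e.
have ends : ksrc (val (ge io (ge (right_incl M x) f))) = krng (right_br io x q).
  by rewrite src_right (right_br_ends io x q).1 hs.
have ends' : ksrc (val (ge io (ge (right_incl M x) f'))) = krng (right_br io x q1).
  by rewrite src_right (right_br_ends io x q1).1 hs'.
have [e1 e2] : val (ge io (ge (right_incl M x) f)) = val (ge io (ge (right_incl M x) f'))
    /\ right_br io x q = right_br io x q1.
  apply: kfactor_inj => //; first by rewrite !deg_right /= cf.
  by rewrite !right_br_deg cq.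
have ff : f = f'.
  move/val_inj/(bij_inj (ci_ebij io))/(congr1 (fun E => (val E).2)): e1.
  by move=> ?; apply: val_inj.
case: _ / ff in hr' hs' {cf ends' e e1} *.
case: _ / hs in q IH cq e2 {ends} *; case: _ / hs' in q1 cq e2 *.
by rewrite (IH q1) // (Prop_irrelevance hr hr').
Qed.

Lemma is_tri_uniq x y (p : paths (skel L) x y) v w (q : paths (skel M) v w) :
  exists! q', is_tri p q q'.
Proof.
have h : ksrc (left_br io v p) = krng (right_br io y q).
  by rewrite (left_br_ends io v p).2 (right_br_ends io y q).1.
have d : kdeg (kcomp (left_br io v p) (right_br io y q)) =
    row_mx 0 (\sum_(c <- color_order q) c) + row_mx (\sum_(c <- color_order p) c) 0.
  by rewrite kdeg_comp // left_br_deg right_br_deg addrC.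
have [[b a] [/= [hs e db da] _]] := kfactor d.
have [|w' [q' [cq bE]]] :=
    right_path (io := io) (x := x) (v := v) (color_order_basis q) db.
  by rewrite -(left_br_ends io v p).1 -(krng_comp h) -e krng_comp.
have ra : rsubmx (kdeg a) = 0 by rewrite da row_mxKr.
have ww : w = w'.
  have : in_left io w' a.
    by apply/in_leftP; split=> //; exists x; rewrite -hs bE (right_br_ends io x q').2.
  move=> [x' [y' [p' aE]]].
  have := ksrc_comp h; rewrite -e ksrc_comp // aE (left_br_ends io w' p').2.
  by rewrite (right_br_ends io y q).2 => /gv_inj [_ ->].
case: _ / ww in q' cq bE *.
exists q'; split; first by split=> //; exists a; rewrite -bE.
move=> q1 [cq1 [a1 [ra1 hs1 e1]]]; apply: (@right_br_inj x); first by rewrite cq.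
rewrite -bE.
have da1 : kdeg a1 = kdeg a.
  have := congr1 (fun c => lsubmx (kdeg c)) (etrans e1 (esym e)).
  rewrite /= !kdeg_comp // !lsubmx_add right_br_deg db !row_mxKl !add0r => dl.
  by rewrite -[LHS]hsubmxK -[RHS]hsubmxK ra ra1 dl.
have [] // := @kfactor_inj _ O b a (right_br io x q1) a1; rewrite ?e ?e1 //.
by rewrite db right_br_deg cq1.
Qed.

Definition tri x y (p : paths (skel L) x y) v w (q : paths (skel M) v w) :
    paths (skel M) v w :=
  sval (cid (is_tri_uniq p q)).

Lemma triP x y (p : paths (skel L) x y) v w (q : paths (skel M) v w) :
  is_tri p q (tri p q).
Proof. by case: (svalP (cid (is_tri_uniq p q))). Qed.

(* [right_cls x q] is [q]_x in Omega_2^x. *)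
Definition right_cls x v w (q : paths (skel M) v w) : kmor (Omega2 io x) :=
  exist (in_right io x) (right_br io x q)
    (ex_intro _ v (ex_intro _ w (ex_intro _ q erefl))).

Lemma right_cls_surj x (b : kmor (Omega2 io x)) :
  exists t : {v : kobj M & {w : kobj M & paths (skel M) v w}},
    b = right_cls x (projT2 (projT2 t)).
Proof.
case: b => b Pb; have [v [w [q bE]]] := Pb.
by exists (existT _ v (existT _ w q)); apply: sub_eq.
Qed.

(* The value does not depend on the chosen representative: see [tri_hatE]. *)
Definition tri_hat x y (p : paths (skel L) x y) (b : kmor (Omega2 io y)) :
    kmor (Omega2 io x) :=
  let t := sval (cid (right_cls_surj b)) in
  right_cls x (tri p (projT2 (projT2 t))).

Lemma tri_hatE x y (p : paths (skel L) x y) v w (q : paths (skel M) v w) :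
  tri_hat p (right_cls y q) = right_cls x (tri p q).
Proof.
rewrite /tri_hat; case: (cid _) => -[v' [w' q']] /= /(congr1 sval) /= E.
have vv : v = v'.
  have := (right_br_ends io y q).1.
  by rewrite E (right_br_ends io y q').1 => /gv_inj [_ ->].
have ww : w = w'.
  have := (right_br_ends io y q).2.
  by rewrite E (right_br_ends io y q').2 => /gv_inj [_ ->].
case: _ / vv in q' E *; case: _ / ww in q' E *.
apply: sub_eq => /=.
have [c1 [a1 [r1 h1 e1]]] := triP p q.
have [c2 [a2 [r2 h2 e2]]] := triP p q'.
have e12 := etrans e2 (etrans (congr1 (kcomp (left_br io v p)) (esym E)) (esym e1)).
have := congr1 (fun c => kdeg c) e12; rewrite !kdeg_comp // => dd.
have dl := congr1 lsubmx dd; have dr := congr1 rsubmx dd.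
move: dl dr; rewrite !lsubmx_add !rsubmx_add r1 r2 !addr0 !right_br_deg.
rewrite !row_mxKl !add0r !row_mxKr => dl dr.
have [] // := kfactor_inj h2 h1 e12; first by rewrite !right_br_deg dr.
by rewrite -[LHS]hsubmxK -[RHS]hsubmxK r1 r2 dl.
Qed.

Lemma bij_inverse A B (f : A -> B) :
  bijective f -> exists g : B -> A, cancel f g /\ cancel g f.
Proof. by case=> g fK gK; exists g. Qed.

Definition inverse A B (f : A -> B) (fb : bijective f) : B -> A :=
  sval (cid (bij_inverse fb)).

Definition edge_path (G : digraph) x y (e : edge G) (hr : erng e = x)
    (hs : esrc e = y) : paths G x y :=
  pcons e hr hs pnil.

Definition signed_hat
    (bij : forall x y (p : paths (skel L) x y), bijective (tri_hat p))
    x z (e : edge (hat_graph (skel L))) :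
    erng e = x -> esrc e = z -> kmor (Omega2 io z) -> kmor (Omega2 io x) :=
  match e with
  | (e, true) => fun hr hs => tri_hat (@edge_path (skel L) x z e hr hs)
  | (e, false) => fun hr hs => inverse (bij z x (@edge_path (skel L) z x e hs hr))
  end.

Fixpoint zigzag_hat
    (bij : forall x y (p : paths (skel L) x y), bijective (tri_hat p))
    x y (xi : paths (hat_graph (skel L)) x y) :
    kmor (Omega2 io y) -> kmor (Omega2 io x) :=
  match xi in gpath _ x0 return kmor (Omega2 io y) -> kmor (Omega2 io x0) with
  | pnil => id
  | pcons _ _ _ hr hs xi' => signed_hat bij hr hs \o zigzag_hat bij xi'
  end.

End Action.

Definition stable_right k1 k2 (L : kgraph k1) (M : kgraph k2)
    (O : kgraph (k1 + k2)) (Q : quasi_product L M O) : Prop :=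
  forall x y (p : paths (skel L) x y) v w (q : paths (skel M) v w),
    tri Q p q = q.

(* Main.v *)
(* Omega itself serves as the stable quasi-product: only the identification of
   its one-skeleton with that of Lambda x Gamma has to change.  Fix a vertex x0
   of Lambda and, for each x, a path in the doubled graph from x0 to x.  The
   induced bijection theta_x from Omega_2^x0 to Omega_2^x preserves degree,
   range and source, hence permutes the edges of Gamma, f being sent to T_x f.
   Path independence applied to an edge e of Lambda reads
   e^ o theta_{s(e)} = theta_{r(e)}, so after relabelling each edge (x, f) as
   (x, T_x f) every commuting square of Omega with sides e and f has the same f
   on both sides.  Pasting such squares gives stability for all paths. *)
Require Import Defs.
From mathcomp Require Import all_boot all_order all_algebra.
From mathcomp Require Import boolp.
From Stdlib Require Import Relation_Operators.

Set Implicit Arguments.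
Unset Strict Implicit.
Unset Printing Implicit Defensive.

Import GRing.Theory.
Local Open Scope ring_scope.

(** * Bijections, sub-k-graphs and degrees of edges *)

Lemma inj_surj_bij A B (f : A -> B) :
  injective f -> (forall b, exists a, f a = b) -> bijective f.
Proof.
move=> fi fs; exists (fun b => sval (cid (fs b))) => [a|b].
  by apply: fi; case: (cid _).
by case: (cid _).
Qed.

Lemma inverseK A B (f : A -> B) (fb : bijective f) :
  cancel f (inverse fb) /\ cancel (inverse fb) f.
Proof. by rewrite /inverse; case: (cid _). Qed.

Lemma kisomorphic_refl k (O : kgraph k) : kisomorphic O O.
Proof.
by exists (@KFunctor _ _ O O id id (fun=> erefl) (fun=> erefl) (fun=> erefl)
  (fun _ _ _ => erefl)); split=> //; exists id.
Qed.

(** An equality rather than an isomorphism, so that the base conditions of a quasi-product transfer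
    by rewriting. *)
Lemma sub_kgraph_ext k l (O : kgraph k) j pi (P P' : kmor O -> Prop)
    (H : @subcat k l O j pi P) (H' : subcat j pi P') :
  (forall a, P a <-> P' a) -> sub_kgraph H = sub_kgraph H'.
Proof.
move=> PP'; have e : P = P' by apply: funext => a; apply: propext.
by case: _ / e in H' *; rewrite (Prop_irrelevance H H').
Qed.

(** The single nonzero entry falls into one of the two blocks. *)
Lemma is_basis_row_mx k l (m : 'N^k) (n : 'N^l) : is_basis (row_mx m n) ->
  is_basis m /\ n = 0 \/ m = 0 /\ is_basis n.
Proof.
case/existsP=> i /eqP E; case: (split_ordP i) => i' ei; [left|right].
- split; last first.
    apply/rowP => j; have := congr1 (fun u : 'rV_(_ + _) => u 0 (rshift k j)) E.
    by rewrite row_mxEr ei !mxE eq_rlshift andbF.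
  apply/existsP; exists i'; apply/eqP/rowP => j.
  have := congr1 (fun u : 'rV_(_ + _) => u 0 (lshift l j)) E.
  by rewrite row_mxEl ei !mxE eq_lshift.
- split.
    apply/rowP => j; have := congr1 (fun u : 'rV_(_ + _) => u 0 (lshift l j)) E.
    by rewrite row_mxEl ei !mxE eq_lrshift andbF.
  apply/existsP; exists i'; apply/eqP/rowP => j.
  have := congr1 (fun u : 'rV_(_ + _) => u 0 (rshift k j)) E.
  by rewrite row_mxEr ei !mxE eq_rshift.
Qed.

Lemma is_basis0 k : is_basis (0 : 'N^k) = false.
Proof.
apply/existsP => -[i /eqP/rowP /(_ i)].
by rewrite !mxE !eqxx.
Qed.

Lemma prod_edgeP k l (L : kgraph k) (M : kgraph l) (E : edge (skel (kprod L M))) :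
  (exists w e, E = ge (left_incl L w) e) \/
  (exists x f, E = ge (right_incl M x) f).
Proof.
case: E => -[a b] /= h; case: (is_basis_row_mx h) => -[ha hb]; [left|right].
  exists (krng b), (exist _ a ha); apply: val_inj => /=.
  by rewrite [b in LHS]deg0_id.
exists (krng a), (exist _ b hb); apply: val_inj => /=.
by rewrite [a in LHS]deg0_id.
Qed.

(** * Relabelling the edges $(x,f)$ of the product skeleton *)

Section Relabelling.
Context (k l : nat) (L : kgraph k) (M : kgraph l).

(* An edge of the product is a pair whose second component is an edge of M exactly
   when it has the form (x, f), so [insub] selects the edges to be relabelled. *)
Definition relabel (T : kobj L -> edge (skel M) -> edge (skel M))
    (E : edge (skel (kprod L M))) : edge (skel (kprod L M)) :=
  if insub (val E).2 is Some f
  then ge (right_incl M (krng (val E).1)) (T (krng (val E).1) f) else E.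

(** The second component is an identity, of degree 0, hence not an edge, and [insub] fails. *)
Lemma relabel_left T w e : relabel T (ge (left_incl L w) e) = ge (left_incl L w) e.
Proof. by rewrite /relabel insubN //= kdeg_id is_basis0. Qed.

Lemma relabel_right T x f :
  relabel T (ge (right_incl M x) f) = ge (right_incl M x) (T x f).
Proof. by rewrite /relabel /= krng_id (valK f). Qed.

Lemma relabelK T T' : (forall x, cancel (T x) (T' x)) ->
  cancel (relabel T) (relabel T').
Proof.
move=> TK E; have [[w [e ->]]|[x [f ->]]] := prod_edgeP E.
  by rewrite !relabel_left.
by rewrite !relabel_right TK.
Qed.

Context (T : kobj L -> edge (skel M) -> edge (skel M)).
Hypothesis T_rng : forall x f, erng (T x f) = erng f.
Hypothesis T_src : forall x f, esrc (T x f) = esrc f.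
Hypothesis T_col : forall x f, ecol (T x f) = ecol f.
Hypothesis T_bij : forall x, bijective (T x).

Fact relabel_rng E : erng (relabel T E) = erng E.
Proof.
have [[w [e ->]]|[x [f ->]]] := prod_edgeP E; first by rewrite relabel_left.
by rewrite relabel_right; congr pair; apply: T_rng.
Qed.

Fact relabel_src E : esrc (relabel T E) = esrc E.
Proof.
have [[w [e ->]]|[x [f ->]]] := prod_edgeP E; first by rewrite relabel_left.
by rewrite relabel_right; congr pair; apply: T_src.
Qed.

Fact relabel_col E : ecol (relabel T E) = ecol E.
Proof.
have [[w [e ->]]|[x [f ->]]] := prod_edgeP E; first by rewrite relabel_left.
by rewrite relabel_right; congr row_mx; apply: T_col.
Qed.

Fact relabel_bij : bijective (relabel T).
Proof.
by exists (relabel (fun x => inverse (T_bij x))); apply: relabelK => x;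
  case: (inverseK (T_bij x)).
Qed.

Context (O : kgraph (k + l)) (io : cgiso (skel (kprod L M)) (skel O)).

Definition relabel_iso : cgiso (skel (kprod L M)) (skel O) :=
  @CGIso _ (skel (kprod L M)) (skel O)
    (@GMor (skel (kprod L M)) (skel O) (gv io) (ge io \o relabel T)
      (fun E => etrans (gmor_rng io _) (congr1 (gv io) (relabel_rng E)))
      (fun E => etrans (gmor_src io _) (congr1 (gv io) (relabel_src E))))
    (ci_vbij io) (bij_comp (ci_ebij io) relabel_bij)
    (fun E => etrans (ci_col io _) (relabel_col E)).

(** Membership depends only on the degree and on the vertex map, and relabelling changes neither. *)
Lemma Omega1_relabel w : Omega1 relabel_iso w = Omega1 io w.
Proof. by apply: sub_kgraph_ext => a; rewrite !in_leftP. Qed.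

Lemma Omega2_relabel x : Omega2 relabel_iso x = Omega2 io x.
Proof. by apply: sub_kgraph_ext => a; rewrite !in_rightP. Qed.

End Relabelling.

(** * Pasting commuting squares *)

Section Squares.
Context (k1 k2 : nat) (L : kgraph k1) (M : kgraph k2) (O : kgraph (k1 + k2)).
Context (io : cgiso (skel (kprod L M)) (skel O)).

Definition ledge w (e : edge (skel L)) : kmor O := val (ge io (ge (left_incl L w) e)).
Definition redge x (f : edge (skel M)) : kmor O := val (ge io (ge (right_incl M x) f)).

Lemma rng_left w e : krng (ledge w e) = gv io (erng e, w).
Proof.
by have /= -> := gmor_rng io (ge (left_incl L w) e); rewrite /kprod_rng /= krng_id.
Qed.

Lemma rng_right x f : krng (redge x f) = gv io (x, erng f).
Proof.
by have /= -> := gmor_rng io (ge (right_incl M x) f); rewrite /kprod_rng /= krng_id.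
Qed.

Lemma redge_inj x : injective (redge x).
Proof.
move=> f g /val_inj/(bij_inj (ci_ebij io))/(congr1 (fun E => (val E).2)) /= fg.
exact: val_inj.
Qed.

Lemma left_br_edge w x y e hr hs :
  left_br io w (@edge_path (skel L) x y e hr hs) = ledge w e.
Proof. by rewrite /left_br /= -hs -src_left kcomp_idr. Qed.

Lemma right_br_edge x v w f hr hs :
  right_br io x (@edge_path (skel M) v w f hr hs) = redge x f.
Proof. by rewrite /right_br /= -hs -src_right kcomp_idr. Qed.

(** The edge of $\Lambda$ may change when it crosses [f]: stability constrains only the $\Gamma$
    side. *)
Hypothesis square : forall (e : edge (skel L)) (f : edge (skel M)),
  exists e' : edge (skel L),
  [/\ erng e' = erng e, esrc e' = esrc e &
      kcomp (ledge (erng f) e) (redge (esrc e) f)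
      = kcomp (redge (erng e) f) (ledge (esrc f) e')].

(** The edge [e] crosses the edges of [q] one at a time. The induction is general in [e], which may
    be replaced by a parallel edge at each crossing. *)
Lemma square_path (e : edge (skel L)) v w (q : paths (skel M) v w) :
  exists e' : edge (skel L),
  [/\ erng e' = erng e, esrc e' = esrc e &
      kcomp (ledge v e) (right_br io (esrc e) q)
      = kcomp (right_br io (erng e) q) (ledge w e')].
Proof.
elim: q e => [|v' z f hr hs q IH] e.
  exists e; split=> //; rewrite /right_br /=.
  by rewrite -src_left kcomp_idr -rng_left kcomp_idl.
case: _ / hs in q IH *; case: _ / hr.
have [e1 [r1 s1 E1]] := square e f.
have [e2 [r2 s2 E2]] := IH e1.
rewrite r1 s1 in r2 s2 E2; exists e2; split=> //.
rewrite {1 2}/right_br /= -!/(right_br _ _ _) -!/(redge _ _).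
have rq x : krng (right_br io x q) = gv io (x, esrc f) := (right_br_ends io x q).1.
have sq x : ksrc (right_br io x q) = gv io (x, w) := (right_br_ends io x q).2.
rewrite kcompA ?src_left ?rng_right ?src_right ?rq // E1.
rewrite -kcompA ?src_left ?rng_left ?src_right ?r1 ?s1 ?rq // E2.
by rewrite kcompA ?src_right ?rq ?sq ?rng_left ?r2.
Qed.

(** The edges of [p] cross [q] in turn, the last one first; [q] comes out unchanged each time, so it
    stays fixed in the induction. *)
Lemma square_paths x y (p : paths (skel L) x y) v w (q : paths (skel M) v w) :
  exists p' : paths (skel L) x y,
    kcomp (left_br io v p) (right_br io y q)
    = kcomp (right_br io x q) (left_br io w p').
Proof.
elim: p => [|x' z e hr hs p [p' IH]].
  exists pnil; rewrite /left_br /=.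
  by rewrite -(right_br_ends io y q).1 -(right_br_ends io y q).2 kcomp_idl kcomp_idr.
case: _ / hs p p' IH => p p' IH; case: _ / hr.
have [e' [r s E]] := square_path e q.
exists (pcons e' r s p'); rewrite {1 2}/left_br /= -!/(left_br _ _ _) -!/(ledge _ _).
have lp u (p1 : paths (skel L) (esrc e) y) := left_br_ends io u p1.
have rp u := right_br_ends io u q.
rewrite -kcompA ?(lp _ _).1 ?(lp _ _).2 ?(rp _).1 ?src_left // IH.
rewrite kcompA ?(lp _ _).1 ?(rp _).1 ?(rp _).2 ?src_left // E.
by rewrite -kcompA ?(lp _ _).1 ?(rp _).2 ?src_left ?rng_left ?r ?s.
Qed.

Lemma tri_square x y (p : paths (skel L) x y) v w (q : paths (skel M) v w) :
  tri io p q = q.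
Proof.
(* By uniqueness of the factorization it is enough that [q] itself satisfies [is_tri]. *)
have [r [_ ru]] := is_tri_uniq io p q; rewrite -(ru _ (triP io p q)); apply: ru.
have [p' E] := square_paths p q; split=> //; exists (left_br io w p'); split=> //.
  by rewrite left_br_deg row_mxKr.
by rewrite (right_br_ends io x q).2 (left_br_ends io w p').1.
Qed.

End Squares.

(** * Degree, range and source under the induced maps *)

Section Transport.
Context (k1 k2 : nat) (L : kgraph k1) (M : kgraph k2) (O : kgraph (k1 + k2)).
Context (io : cgiso (skel (kprod L M)) (skel O)).

(** The data [v], [w], [m] refer to $\Gamma$ alone, so they can be compared between fibres over
    different vertices [x]. *)
Definition has_type x v w (m : 'N^k2) (b : kmor (Omega2 io x)) : Prop :=
  [/\ krng (sval b) = gv io (x, v), ksrc (sval b) = gv io (x, w) &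
      kdeg (sval b) = row_mx 0 m].

Lemma has_type_cls x v w (q : paths (skel M) v w) :
  has_type v w (\sum_(c <- color_order q) c) (right_cls io x q).
Proof. by have [r s] := right_br_ends io x q; split=> //; apply: right_br_deg. Qed.

Lemma has_type_ex x (b : kmor (Omega2 io x)) : exists v w m, has_type v w m b.
Proof.
have [[v [w q]] ->] := right_cls_surj b.
by do 3!eexists; apply: has_type_cls.
Qed.

Lemma has_type_uniq x (b : kmor (Omega2 io x)) v w m v' w' m' :
  has_type v w m b -> has_type v' w' m' b -> [/\ v = v', w = w' & m = m'].
Proof.
by case=> r s d []; rewrite r s d => /gv_inj [_ ->] /gv_inj [_ ->] /eq_row_mx [_ ->].
Qed.

Definition keeps_type x y (f : kmor (Omega2 io y) -> kmor (Omega2 io x)) : Prop :=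
  forall v w m b, has_type v w m b -> has_type v w m (f b).

(** Every element has a type, and [f] carries that of [g b] to [b]; uniqueness of types identifies
    the two. *)
Lemma keeps_type_inv x y f g : @keeps_type x y f -> cancel g f -> keeps_type g.
Proof.
move=> ft gK v w m b bt; have [v' [w' [m' t']]] := has_type_ex (g b).
by have := ft _ _ _ _ t'; rewrite gK => /(has_type_uniq bt) [-> -> ->].
Qed.

Lemma tri_hat_type x y (p : paths (skel L) x y) : keeps_type (@tri_hat _ _ _ _ _ io _ _ p).
Proof.
move=> v w m b bt; have [[v' [w' q]] bE] := right_cls_surj b.
rewrite /= in bE.
have := has_type_cls y q; rewrite -bE => /(has_type_uniq bt) [-> -> ->].
rewrite bE tri_hatE -(triP io p q).1; exact: has_type_cls.
Qed.

(** The factorization defining [tri], restated for classes and thus free of representatives. *)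
Lemma tri_hat_comm x y (p : paths (skel L) x y) v w m b : has_type v w m b ->
  exists alpha, [/\ rsubmx (kdeg alpha) = 0, ksrc (sval (tri_hat p b)) = krng alpha &
    kcomp (sval (tri_hat p b)) alpha = kcomp (left_br io v p) (sval b)].
Proof.
move=> bt; have [[v' [w' q]] bE] := right_cls_surj b.
rewrite /= in bE.
have := has_type_cls y q; rewrite -bE => /(has_type_uniq bt) [-> _ _].
rewrite bE tri_hatE; exact: (triP io p q).2.
Qed.

Lemma redge_in_right x f : in_right io x (redge io x f).
Proof.
apply/in_rightP; split; first by rewrite deg_right row_mxKl.
by exists (erng f); apply: rng_right.
Qed.

Definition rcls x f : kmor (Omega2 io x) :=
  exist (in_right io x) (redge io x f) (redge_in_right x f).

Lemma rcls_inj x : injective (rcls x).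
Proof. by move=> f g /(congr1 sval) /redge_inj. Qed.

Lemma has_type_rcls x (f : edge (skel M)) : has_type (erng f) (esrc f) (ecol f) (rcls x f).
Proof. by split; [apply: rng_right | apply: src_right | apply: deg_right]. Qed.

Lemma rclsP x v w m b : is_basis m -> @has_type x v w m b -> exists f, b = rcls x f.
Proof.
move=> bm [rb _ db]; have [f [_ _ bE]] := right_edge bm db rb.
by exists f; apply: sub_eq.
Qed.

Context (bij : forall x y (p : paths (skel L) x y), bijective (tri_hat (io := io) p)).

Lemma signed_hat_spec x z (e : edge (hat_graph (skel L))) hr hs :
  bijective (@signed_hat _ _ _ _ _ io bij x z e hr hs) /\
  keeps_type (@signed_hat _ _ _ _ _ io bij x z e hr hs).
Proof.
case: e hr hs => e [] hr hs /=; first by split; [apply: bij | apply: tri_hat_type].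
have [K1 K2] := inverseK (bij (@edge_path (skel L) z x e hs hr)).
split; first by exists (tri_hat (@edge_path (skel L) z x e hs hr)).
exact: keeps_type_inv (tri_hat_type _) K2.
Qed.

Lemma zigzag_hat_spec x y (xi : paths (hat_graph (skel L)) x y) :
  bijective (zigzag_hat bij xi) /\ keeps_type (zigzag_hat bij xi).
Proof.
elim: xi => [|x' z e hr hs xi [IHb IHt]] /=; first by split=> //; exists id.
have [sb st] := signed_hat_spec hr hs; split; first exact: bij_comp sb IHb.
by move=> v w m b /IHt/st.
Qed.

End Transport.

(** * Paths in the doubled graph of a connected graph *)

Fixpoint gcat (G : digraph) x y z (p : paths G x y) (q : paths G y z) : paths G x z :=
  match p in gpath _ x0 return paths G x0 z with
  | pnil => q
  | pcons _ _ e hr hs p' => pcons e hr hs (gcat p' q)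
  end.

Lemma connected_hat_path (G : digraph) : connected_graph G ->
  forall x y, inhabited (paths (hat_graph G) x y).
Proof.
move=> Gc x y.
(* Carrying both directions through the induction makes the symmetry case a swap. *)
suff: inhabited (paths (hat_graph G) x y) /\ inhabited (paths (hat_graph G) y x).
  by case.
elim: {x y}(Gc x y) => [x y [e [r s]]|x|x y _ []|x y z _ [[p] [p']] _ [[q] [q']]] //.
- split; constructor.
    exact: (@pcons (hat_graph G) _ _ _ (e, true) r s pnil).
  exact: (@pcons (hat_graph G) _ _ _ (e, false) s r pnil).
- by split; constructor; apply: pnil.
- by split; constructor; [apply: gcat p q | apply: gcat q' p'].
Qed.

Theorem theorem5p4 (k1 k2 : nat) (L : kgraph k1) (M : kgraph k2)
  (O : kgraph (k1 + k2)) (Q : quasi_product L M O)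
  (L_connected : kconnected L)
  (hat_bij : forall (x y : kobj L) (p : paths (skel L) x y),
     bijective (tri_hat (io := Q) p))
  (hat_indep : forall (x y : kobj L)
     (xi xi' : paths (hat_graph (skel L)) x y)
     (b : kmor (Omega2 Q y)),
     zigzag_hat hat_bij xi b = zigzag_hat hat_bij xi' b) :
  exists (O' : kgraph (k1 + k2)) (Q' : quasi_product L M O'),
    stable_right Q' /\ kisomorphic O O'.
Proof.
have [x0 _] := qp_base2 Q.
have conn x := connected_hat_path L_connected x x0.
(* [inhabited] is recast as an existence statement so that choice can extract a path. *)
pose xi x : paths (hat_graph (skel L)) x x0 :=
  sval (cid (let: inhabits p := conn x in ex_intro (fun=> True) p I)).
pose theta x := zigzag_hat hat_bij (xi x).
have theta_bij x : bijective (theta x) := (zigzag_hat_spec hat_bij (xi x)).1.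
have theta_type x : keeps_type (theta x) := (zigzag_hat_spec hat_bij (xi x)).2.
have theta_edge x f : exists g, theta x (rcls Q x0 f) = rcls Q x g.
  apply: rclsP (valP f) (theta_type x _ _ _ _ (has_type_rcls _ _ _)).
pose T x f := sval (cid (theta_edge x f)).
have TE x f : theta x (rcls Q x0 f) = rcls Q x (T x f) := svalP (cid (theta_edge x f)).
have T_type x (f : edge (skel M)) :
    [/\ erng (T x f) = erng f, esrc (T x f) = esrc f & ecol (T x f) = ecol f].
  have := theta_type x _ _ _ _ (has_type_rcls Q x0 f); rewrite TE.
  exact: has_type_uniq (has_type_rcls _ _ _).
have T_rng x (f : edge (skel M)) : erng (T x f) = erng f by case: (T_type x f).
have T_src x (f : edge (skel M)) : esrc (T x f) = esrc f by case: (T_type x f).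
have T_col x (f : edge (skel M)) : ecol (T x f) = ecol f by case: (T_type x f).
have T_bij x : bijective (T x).
  apply: inj_surj_bij => [f g fg|g].
    by apply: (@rcls_inj _ _ _ _ _ Q x0); apply: (bij_inj (theta_bij x)); rewrite !TE fg.
  (* Surjectivity: the inverse of [theta x] keeps types too, so it sends edges to edges. *)
  have [h _ hK] := theta_bij x.
  have ht := keeps_type_inv (theta_type x) hK.
  have [f fE] := rclsP (valP g) (ht _ _ _ _ (has_type_rcls Q x g)).
  by exists f; apply: (@rcls_inj _ _ _ _ _ Q x); rewrite -TE -fE hK.
have theta_step (e : edge (skel L)) b :
    tri_hat (@edge_path (skel L) _ _ e erefl erefl) (theta (esrc e) b) = theta (erng e) b.
  (* Prefixing [xi (esrc e)] with $e_+$ gives a second path from [x0] to [erng e], to be compared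
     with [xi (erng e)]. *)
  exact: (hat_indep _ _
    (@pcons (hat_graph (skel L)) _ _ _ (e, true) erefl erefl (xi (esrc e)))).
pose io' := relabel_iso T_rng T_src T_col T_bij Q.
have [w0 b1] := qp_base1 Q; have [x1 b2] := qp_base2 Q.
have ledgeE w e : ledge io' w e = ledge Q w e.
  by rewrite /ledge /= relabel_left.
have redgeE x f : redge io' x f = redge Q x (T x f).
  by rewrite /redge /= relabel_right.
have base1 : exists w0, kisomorphic (Omega1 io' w0) L by exists w0; rewrite Omega1_relabel.
have base2 : exists x0, kisomorphic (Omega2 io' x0) M by exists x1; rewrite Omega2_relabel.
(* The injective functors carry over as they are, since their conditions do not mention the
   identification of skeletons. *)
exists O, (QuasiProduct (qp_psi1 Q) (qp_psi2 Q) base1 base2).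
split; last exact: kisomorphic_refl.
move=> x y p v w q; apply: tri_square => {x y p v w q} e f.
rewrite ledgeE !redgeE.
have t := has_type_rcls Q (esrc e) (T (esrc e) f); rewrite T_rng in t.
have [a []] := tri_hat_comm (@edge_path (skel L) _ _ e erefl erefl) t.
(* [theta_step] turns the image of the edge labelled [T (esrc e) f] into the one labelled
   [T (erng e) f]: both carry the new label [f]. *)
rewrite -TE theta_step !TE left_br_edge /= => ra sa Ea.
have sl : ksrc (ledge Q (erng f) e) = krng (redge Q (esrc e) (T (esrc e) f)).
  by rewrite src_left rng_right T_rng.
(* The $\Gamma$ edges have zero first block, so comparing first blocks in [Ea] gives [a] the color
   of [e]; hence [a] is an edge. *)
have da : kdeg a = row_mx (ecol e) 0.
  have := congr1 (fun c => lsubmx (kdeg c)) Ea.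
  rewrite /= !kdeg_comp // !lsubmx_add !deg_right deg_left !row_mxKl add0r addr0 => dl.
  by rewrite -[LHS]hsubmxK ra dl.
have [|e' [_ re' aE]] := left_edge (io := Q) (w := esrc f) (x := erng e) (valP e) da.
  by rewrite -sa src_right T_src.
exists e'; split=> //; last by rewrite ledgeE -Ea aE.
(* The source of [e'] is read off from the common source of the two composites. *)
have := congr1 (fun c => ksrc c) Ea; rewrite /= !ksrc_comp // aE src_left src_right.
by case/gv_inj.
Qed.
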